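(* Let $(R,\mathfrak m)$ be a $d$-dimensional noetherian local integral domain which is not a field, with fraction field $Q$ and $\mathfrak m$-adic completion $\widehat R$. The following are equivalent: (i) $\operatorname{Hom}_R(B,\widehat R)\neq 0$ for every nonzero proper $R$-submodule $0\ne B\subsetneq Q$. (ii) $d=1$. *)

(* Defs.v *)
From HB Require Import structures.
From mathcomp Require Import all_boot all_order all_algebra.
From mathcomp Require Import generic_quotient ring_quotient fraction.
From mathcomp Require Import boolp.

Set Implicit Arguments.
Unset Strict Implicit.
Unset Printing Implicit Defensive.

Import GRing.Theory.
Local Open Scope ring_scope.
Local Open Scope quotient_scope.

(* Ideals, prime ideals and submodules are boolean predicates here, as in the  *)
(* Mathematical Components library.  Under the classical axioms of boolp every *)
(* Prop-valued predicate is reflected by a boolean one (asboolP), so they      *)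
(* range over all ideals (resp. submodules).  Note that the structures idealr  *)
(* and prime_idealr contain only proper ideals.                                *)

Section CommutativeAlgebra.
Variable R : comNzRingType.

(* Submodules of R^o are the ideals of R, the unit ideal included. *)
Definition noetherian : Prop :=
  forall I : submodClosed R^o, exists s : seq R,
    forall x : R, x \in I <-> exists c : nat -> R, x = \sum_(i < size s) c i * s`_i.

Definition maximal_ideal (I : idealr R) : Prop :=
  forall J : idealr R, {subset I <= J} -> J =i I.

Definition local_with_maximal_ideal (I : idealr R) : Prop :=
  maximal_ideal I /\ forall J : idealr R, maximal_ideal J -> J =i I.

(* A chain P_0 < P_1 < ... < P_n has length n. *)
Definition prime_chain (n : nat) (P : 'I_n.+1 -> prime_idealr R) : Prop :=
  forall i j : 'I_n.+1, (i < j)%N ->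
    {subset P i <= P j} /\ exists2 x, x \in P j & x \notin P i.

Definition has_krull_dim (d : nat) : Prop :=
  (exists P : 'I_d.+1 -> prime_idealr R, prime_chain P) /\
  (forall n (P : 'I_n.+1 -> prime_idealr R), prime_chain P -> (n <= d)%N).

Definition ideal_mul (I J : {pred R}) : {pred R} :=
  fun x => `[< exists s : seq (R * R),
                 {in s, forall p, p.1 \in I /\ p.2 \in J}
                 /\ x = \sum_(p <- s) p.1 * p.2 >].

Definition ideal_exp (I : {pred R}) (n : nat) : {pred R} :=
  iter n (ideal_mul I) predT.

End CommutativeAlgebra.

Section PositivePowers.
Variables (R : comNzRingType) (I : idealr R).

Lemma ideal_expS_idealr_closed n : idealr_closed (ideal_exp I n.+1).
Proof.
split.
- by apply/asboolP; exists [::]; rewrite big_nil.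
- apply/asboolPn => -[s [sP s1]]; have := idealr1 I; rewrite s1.
  rewrite big_seq rpred_sum // => p /sP[pI _].
  by rewrite mulrC idealMr.
- move=> a u v /asboolP[s [sP ->]] /asboolP[t [tP ->]]; apply/asboolP.
  exists ([seq (a * p.1, p.2) | p <- s] ++ t); split.
    move=> p; rewrite mem_cat => /orP[/mapP[q /sP[q1 q2] ->]/=|/tP//].
    by split=> //; exact: idealMr.
  rewrite big_cat big_map mulr_sumr; congr (_ + _).
  by apply: eq_bigr => p _; rewrite mulrA.
Qed.

HB.instance Definition _ n :=
  isIdealr.Build R (ideal_exp I n.+1) (ideal_expS_idealr_closed n).

Definition pos_power (n : nat) : idealr R := ideal_exp I n.+1.

(* The inverse limit of the rings R / I^(n+1), n : nat; the term R / I^0 = 0   *)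
(* of the usual system is omitted, as idealr and {ideal_quot _} only cover     *)
(* proper ideals.  A family is coherent when its (n+1)-st component maps to    *)
(* its n-th one under the projection R / I^(n+2) -> R / I^(n+1).               *)
Definition proj n (a : R) : {ideal_quot pos_power n} := \pi a.

Lemma eq_projP n a b : proj n a = proj n b <-> a - b \in pos_power n.
Proof.
by rewrite Quotient.idealrBE; split=> [ab|/eqP//]; apply/eqP.
Qed.

Lemma proj_repr n (x : {ideal_quot pos_power n}) : proj n (repr x) = x.
Proof. exact: reprK. Qed.

Lemma proj0 n : proj n 0 = 0.
Proof. by rewrite /proj !piE. Qed.

Lemma proj1 n : proj n 1 = 1.
Proof. by rewrite /proj !piE. Qed.

Lemma projN n a : proj n (- a) = - proj n a.
Proof. by rewrite /proj !piE. Qed.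

Lemma projD n a b : proj n (a + b) = proj n a + proj n b.
Proof. by rewrite /proj !piE. Qed.

Lemma projM n a b : proj n (a * b) = proj n a * proj n b.
Proof. by rewrite /proj !piE. Qed.


Definition quot_family := forall n, {ideal_quot pos_power n}.

Definition coherent (x : quot_family) : Prop :=
  forall n, proj n (repr (x n.+1)) = x n.

Record adic_completion := AdicCompletion {
  ac_val : quot_family;
  ac_coherent : `[< coherent ac_val >] }.

HB.instance Definition _ := [isSub for ac_val].
HB.instance Definition _ := [Choice of adic_completion by <:].

Lemma pos_powerSS n : {subset pos_power n.+1 <= pos_power n}.
Proof.
elim: n => [|n IHn] x /asboolP[s [sP ->]]; apply/asboolP; exists s.
  by split=> // p /sP[].
by split=> // p /sP[p1 p2]; split=> //; exact: IHn.
Qed.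

Lemma coherentP (x : quot_family) :
  coherent x <->
  exists r : nat -> R, (forall n, x n = proj n (r n)) /\
                       (forall n, r n.+1 - r n \in pos_power n).
Proof.
split=> [cx|[r [xr rP]] n].
  exists (fun n => repr (x n)); split=> [n|n]; first by rewrite proj_repr.
  by apply/eq_projP; rewrite cx proj_repr.
rewrite [in RHS]xr; apply/eq_projP.
rewrite -[_ - _](subrKA (r n.+1)) rpredD //.
by apply/pos_powerSS/eq_projP; rewrite proj_repr.
Qed.

Lemma coherent0 : coherent (fun=> 0).
Proof.
apply/coherentP; exists (fun=> 0); split=> n; last by rewrite subrr rpred0.
by rewrite proj0.
Qed.

Lemma coherentN x : coherent x -> coherent (fun n => - x n).
Proof.
move=> /coherentP[r [xr rP]]; apply/coherentP; exists (fun n => - r n).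
split=> n; first by rewrite xr projN.
by rewrite -opprD rpredN.
Qed.

Lemma coherentD x y : coherent x -> coherent y -> coherent (fun n => x n + y n).
Proof.
move=> /coherentP[r [xr rP]] /coherentP[t [yt tP]]; apply/coherentP.
exists (fun n => r n + t n); split=> n; first by rewrite xr yt projD.
by rewrite opprD addrACA rpredD.
Qed.

Lemma coherentZ a x : coherent x -> coherent (fun n => proj n a * x n).
Proof.
move=> /coherentP[r [xr rP]]; apply/coherentP.
exists (fun n => a * r n); split=> n; first by rewrite xr projM.
by rewrite -mulrBr idealMr.
Qed.

Definition mk_ac x (cx : coherent x) : adic_completion :=
  AdicCompletion (asboolT cx).

Lemma ac_cohP (x : adic_completion) : coherent (ac_val x).
Proof. exact/asboolP/ac_coherent. Qed.

Definition ac_zero := mk_ac coherent0.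
Definition ac_opp x := mk_ac (coherentN (ac_cohP x)).
Definition ac_add x y := mk_ac (coherentD (ac_cohP x) (ac_cohP y)).
Definition ac_scale (a : R) x := mk_ac (coherentZ a (ac_cohP x)).

Lemma ac_ext (x y : adic_completion) : (forall n, ac_val x n = ac_val y n) -> x = y.
Proof. by move=> xy; apply: val_inj; apply: functional_extensionality_dep. Qed.

Lemma ac_addA : associative ac_add.
Proof. by move=> x y z; apply: ac_ext => n /=; rewrite addrA. Qed.

Lemma ac_addC : commutative ac_add.
Proof. by move=> x y; apply: ac_ext => n /=; rewrite addrC. Qed.

Lemma ac_add0 : left_id ac_zero ac_add.
Proof. by move=> x; apply: ac_ext => n /=; rewrite add0r. Qed.

Lemma ac_addN : left_inverse ac_zero ac_opp ac_add.
Proof. by move=> x; apply: ac_ext => n /=; rewrite addNr. Qed.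

HB.instance Definition _ :=
  GRing.isZmodule.Build adic_completion ac_addA ac_addC ac_add0 ac_addN.

Lemma ac_scaleA a b x : ac_scale a (ac_scale b x) = ac_scale (a * b) x.
Proof. by apply: ac_ext => n /=; rewrite mulrA projM. Qed.

Lemma ac_scale1 : left_id 1 ac_scale.
Proof.
move=> x; apply: ac_ext => n /=.
by rewrite proj1 mul1r.
Qed.

Lemma ac_scaleDr : right_distributive ac_scale +%R.
Proof. by move=> a x y; apply: ac_ext => n /=; rewrite mulrDr. Qed.

Lemma ac_scaleDl x : {morph ac_scale^~ x : a b / a + b}.
Proof.
move=> a b; apply: ac_ext => n /=; by rewrite projD mulrDl.
Qed.

HB.instance Definition _ := GRing.Zmodule_isLmodule.Build R adic_completion
  ac_scaleA ac_scale1 ac_scaleDr ac_scaleDl.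

End PositivePowers.

Section FractionModule.
Variable R : idomainType.

Definition frac_scale (a : R) (x : {fraction R}) : {fraction R} :=
  FracField.tofrac a * x.

Lemma frac_scaleA a b x : frac_scale a (frac_scale b x) = frac_scale (a * b) x.
Proof. by rewrite /frac_scale mulrA rmorphM. Qed.

Lemma frac_scale1 : left_id 1 frac_scale.
Proof. by move=> x; rewrite /frac_scale rmorph1 mul1r. Qed.

Lemma frac_scaleDr : right_distributive frac_scale +%R.
Proof. by move=> a x y; rewrite /frac_scale mulrDr. Qed.

Lemma frac_scaleDl x : {morph frac_scale^~ x : a b / a + b}.
Proof. by move=> a b; rewrite /frac_scale rmorphD mulrDl. Qed.

HB.instance Definition _ := GRing.Zmodule_isLmodule.Build R {fraction R}
  frac_scaleA frac_scale1 frac_scaleDr frac_scaleDl.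

End FractionModule.

Section Submodule.
Variables (R : nzRingType) (V : lmodType R) (B : submodClosed V).

Record submodule := Submodule { sm_val :> V; _ : sm_val \in B }.

HB.instance Definition _ := [isSub for sm_val].
HB.instance Definition _ := [Choice of submodule by <:].
HB.instance Definition _ := [SubChoice_isSubLmodule of submodule by <:].

End Submodule.

Definition Hom_neq0 (R : nzRingType) (M N : lmodType R) : Prop :=
  exists f : {linear M -> N}, exists x, f x != 0.

(* Main.v *)
(* If d > 1, choose a nonzero prime P <> m and x in m \ P. Every element of     *)
(* R[1/x] is divisible by x, so a map from it to the separated module R^ is    *)
(* zero, and R[1/x] <> Q because P is not killed by inverting x.               *)
(*                                                                             *)
(* If d = 1, fix 0 <> x in m. Then Q = R[1/x], R/x is artinian and R^ is the   *)
(* x-adic completion S of R. Given 1 in B < Q, artinianity of R/x makes the    *)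
(* chain R + x^j B stationary, so B may be replaced by some W = R + x W <> Q.  *)
(* Let K be the ideal of those s in S that, for every n, agree modulo x^n with *)
(* some r in R such that r / x^n is in W; it contains no power of x. If        *)
(* y K = 0 then multiplication by y maps W into S, so we only need y <> 0      *)
(* killing a prime p containing K but not x. Now p is finitely generated by    *)
(* successive approximation, and for a in p the x-saturated ideals generated   *)
(* by the a^n are stationary: x^l a^n = a^(n+1) c, so a^n is killed by         *)
(* x^l - a c, which is not in p. The product of these elements over generators *)
(* of p is nonzero and killed by a power of each generator, and a suitable     *)
(* multiple of it is killed by p.                                              *)

Require Import Defs.
From HB Require Import structures.
From mathcomp Require Import all_boot all_order all_algebra.
From mathcomp Require Import ring_quotient fraction.
From mathcomp Require Import boolp classical_sets ring.

Set Implicit Arguments.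
Unset Strict Implicit.
Unset Printing Implicit Defensive.

Import GRing.Theory.
Local Open Scope ring_scope.

(** Write S for the completion. For d > 1, [exists_hom0] finds a proper x-divisible submodule of Q,
    which [divisible_hom0] shows to have no nonzero map into S; [krull_dim_gt0] excludes d = 0. For
    d = 1, [artinian] and [ideal_exp_sub] control the nonzero ideals of R, and
    [adic_completion_along] turns S into an x-adic completion. After the reduction to W = R + x W in
    [dim1_hom_neq0], the module Q / W is x-power torsion, x-divisible and nonzero, so its
    annihilator K in S contains no power of x. By [prime_avoiding] and [prime_annihilator], some y
    <> 0 kills a prime containing K. Each r / x^k in W expands x-adically to an s in S with r - x^k
    s in K, so (r / x^k) y = s y lies in S ([divisible_multiplier]); [multiplier_hom] makes this a
    linear map. *)

(** * Ideals as propositional predicates; noetherian rings *)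

Section Ideals.
Variable A : comNzRingType.

(** Unlike [idealr], this admits the unit ideal, which may occur among the sums, colons and chains
    below. *)
Record is_ideal (I : A -> Prop) : Prop := IsIdeal {
  is_ideal0 : I 0;
  is_idealD : forall a b, I a -> I b -> I (a + b);
  is_idealM : forall a b, I b -> I (a * b) }.

Lemma is_idealN I a : is_ideal I -> I a -> I (- a).
Proof. by move=> II Ia; rewrite -mulN1r; apply: is_idealM. Qed.

Lemma is_idealB I a b : is_ideal I -> I a -> I b -> I (a - b).
Proof. by move=> II Ia Ib; apply: is_idealD => //; apply: is_idealN. Qed.

Lemma is_ideal_sum I n (F : nat -> A) : is_ideal I ->
  (forall i, (i < n)%N -> I (F i)) -> I (\sum_(i < n) F i).
Proof.
move=> II IF; apply: (big_ind I) => [|a b|i _].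
- exact: is_ideal0.
- exact: is_idealD.
- exact: IF.
Qed.

Definition add_principal (I : A -> Prop) a z := exists u r, I u /\ z = u + r * a.

Lemma add_principal_ideal I a : is_ideal I -> is_ideal (add_principal I a).
Proof.
move=> II; split.
- by exists 0, 0; split; [exact: is_ideal0 | ring].
- move=> _ _ [u [r [Iu ->]]] [v [t [Iv ->]]]; exists (u + v), (r + t).
  by split; [exact: is_idealD | ring].
- move=> b _ [u [r [Iu ->]]]; exists (b * u), (b * r).
  by split; [exact: is_idealM | ring].
Qed.

Lemma sub_add_principal I a z : I z -> add_principal I a z.
Proof. by move=> Iz; exists z, 0; split=> //; ring. Qed.

Lemma mem_add_principal I a : is_ideal I -> add_principal I a a.
Proof. by move=> II; exists 0, 1; split; [exact: is_ideal0 | ring]. Qed.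

Lemma colon_ideal I a : is_ideal I -> is_ideal (fun z => I (z * a)).
Proof.
move=> II; split=> [|b c Ib Ic|b c Ic].
- by rewrite mul0r; exact: is_ideal0.
- by rewrite mulrDl; exact: is_idealD.
- by rewrite -mulrA; exact: is_idealM.
Qed.

Lemma principal_ideal a : is_ideal (fun z => exists c, z = a * c).
Proof.
split.
- by exists 0; ring.
- by move=> _ _ [c ->] [e ->]; exists (c + e); ring.
- by move=> b _ [c ->]; exists (b * c); ring.
Qed.

Lemma idealr_is_ideal (I : idealr A) : is_ideal (fun z => z \in I).
Proof.
split.
- exact: rpred0.
- by move=> a b; exact: rpredD.
- by move=> a b; exact: idealMr.
Qed.

Lemma is_ideal_idealr (I : A -> Prop) : is_ideal I -> ~ I 1 ->
  exists J : idealr A, forall z, z \in J <-> I z.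
Proof.
move=> II I1; pose P : {pred A} := fun z => `[<I z>].
have PC : idealr_closed P.
  split; first by apply/asboolP; exact: is_ideal0.
    by apply/asboolPn.
  move=> a u v /asboolP Iu /asboolP Iv; apply/asboolP.
  by apply: is_idealD => //; exact: is_idealM.
pose J : idealr A := HB.pack P (isIdealr.Build A P PC).
by exists J => z; split=> [/asboolP|Iz] //; apply/asboolP.
Qed.

Lemma prime_idealr_of (J : idealr A) :
  prime_idealr_closed J -> exists P : prime_idealr A, P =i J.
Proof.
move=> JP.
pose P : prime_idealr A :=
  HB.pack (J : A -> bool) (isPrimeIdealrClosed.Build A J JP) (Idealr.class J).
by exists P.
Qed.

Lemma noetherian_fg (I : A -> Prop) : noetherian A -> is_ideal I ->
  exists s : seq A, (forall i, (i < size s)%N -> I s`_i) /\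
    forall x, I x -> exists c : nat -> A, x = \sum_(i < size s) c i * s`_i.
Proof.
move=> An II; pose P : {pred A^o} := fun z => `[<I z>].
have PC : submod_closed P.
  split; first by apply/asboolP; exact: is_ideal0.
  move=> a u v /asboolP Iu /asboolP Iv; apply/asboolP.
  by apply: is_idealD => //; exact: is_idealM.
pose J : submodClosed A^o := HB.pack P (GRing.isSubmodClosed.Build A A^o P PC).
have [s sP] := An J; exists s; split=> [i is_|x Ix].
  apply/asboolP/(sP s`_i); exists (fun j => (j == i)%:R).
  rewrite (bigD1 (Ordinal is_)) //= eqxx mul1r big1 ?addr0 // => j.
  by rewrite -val_eqE /= => /negPf ->; rewrite mul0r.
by apply/(sP x)/asboolP.
Qed.

(** Without a maximal member, choice yields a strictly ascending sequence in F. Finitely many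
    generators of its union already lie in one term, which then cannot grow. *)
Lemma noetherian_max (F : (A -> Prop) -> Prop) : noetherian A ->
  (forall I, F I -> is_ideal I) -> (exists I, F I) ->
  exists2 M, F M & forall J, F J -> (forall z, M z -> J z) -> forall z, J z -> M z.
Proof.
move=> An Fideal [I0 FI0]; apply: contrapT => nomax.
have step (M : {I | F I}) : exists J : {I | F I},
    (forall z, sval M z -> sval J z) /\ exists z, sval J z /\ ~ sval M z.
  case: M => M FM /=; apply: contrapT => noJ; apply: nomax; exists M => // J FJ MJ z Jz.
  by apply: contrapT => Mz; apply: noJ; exists (exist _ J FJ); split=> //; exists z.
have [next nextP] := choice step.
pose I_ n := iter n next (exist _ I0 FI0).
have mono n k z : sval (I_ n) z -> sval (I_ (k + n)%N) z.
  by elim: k => // k IHk /IHk; apply: (nextP (I_ (k + n)%N)).1.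
have Iid n : is_ideal (sval (I_ n)) by apply: Fideal; exact: svalP.
have UI : is_ideal (fun z => exists n, sval (I_ n) z).
  split; first by exists 0%N; exact: is_ideal0.
    move=> a b [n In] [k Ik]; exists (k + n)%N; apply: is_idealD => //.
      exact: mono.
    by rewrite addnC; exact: mono.
  by move=> a b [n In]; exists n; exact: is_idealM.
have [s [sI sgen]] := noetherian_fg An UI.
have [N NP] : exists N, forall i, (i < size s)%N -> sval (I_ N) s`_i.
  have : forall k, (k <= size s)%N -> exists N, forall i, (i < k)%N -> sval (I_ N) s`_i.
    elim=> [|k IHk] ks; first by exists 0%N.
    have [N NP] := IHk (ltnW ks); have [n nP] := sI k ks.
    exists (n + N)%N => i; rewrite ltnS leq_eqVlt => /orP[/eqP->|/NP]; last exact: mono.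
    by rewrite addnC; exact: mono.
  exact.
have [z [zS zN]] := (nextP (I_ N)).2.
apply: zN; have [|c ->] := sgen z; first by exists N.+1.
apply: (@is_ideal_sum _ _ (fun i => c i * s`_i)) => // i /NP; exact: is_idealM.
Qed.

End Ideals.

(** * Noetherian local rings *)

Section LocalRing.
Variables (R : comNzRingType) (m : idealr R).
Hypothesis Rnoeth : noetherian R.
Hypothesis Rlocal : local_with_maximal_ideal m.

(** If a is not invertible, an ideal maximal among the proper ideals containing a is a maximal
    ideal, hence equals m. *)
Lemma local_inv a : a \notin m -> exists b, a * b = 1.
Proof.
move=> am; apply: contrapT => ninv.
pose F I := [/\ @is_ideal R I, I a & ~ I 1].
have [||M [Mid Ma M1] Mmax] := @noetherian_max R F Rnoeth.
- by move=> I [].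
- exists (fun z => exists c, z = a * c); split; first exact: principal_ideal.
    by exists 1; rewrite mulr1.
  by move=> [c c1]; apply: ninv; exists c.
have [J JM] := is_ideal_idealr Mid M1.
have Jmax : maximal_ideal J.
  move=> K JK z; apply/idP/idP; last exact: JK.
  move=> Kz; apply/JM; apply: (Mmax (fun z => z \in K)) => // [|w /JM/JK] //.
  split; [exact: idealr_is_ideal | exact/JK/JM | by rewrite idealr1].
by case/negP: am; rewrite -(Rlocal.2 _ Jmax); apply/JM.
Qed.

Lemma local_sub (I : R -> Prop) z : is_ideal I -> ~ I 1 -> I z -> z \in m.
Proof.
move=> II I1 Iz; apply: contra_notT I1 => /local_inv[b zb].
by rewrite -zb mulrC; exact: is_idealM.
Qed.

Lemma local_prime : prime_idealr_closed m.
Proof.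
move=> u v uv; case: (boolP (u \in m)) => //= /local_inv[b ub].
by rewrite -[v]mul1r -ub -mulrA mulrCA idealMr.
Qed.

End LocalRing.

Lemma zero_prime_idealr (R : idomainType) :
  exists O : prime_idealr R, forall z, z \in O <-> z = 0.
Proof.
have Zid : is_ideal (fun z : R => z = 0).
  by split=> [|a b -> ->|a b ->]; rewrite ?addr0 ?mulr0.
have [J JE] := is_ideal_idealr Zid (elimN eqP (oner_neq0 R)).
have [|K KE] := @prime_idealr_of _ J; last by exists K => y; rewrite KE.
move=> u v /JE /eqP; rewrite mulf_eq0 => /orP[/eqP|/eqP] /JE -> //.
by rewrite orbT.
Qed.

(** * Nonzero ideals of a one-dimensional local domain *)

Section DimensionOne.
Variables (R : idomainType) (m : idealr R).
Hypothesis Rnoeth : noetherian R.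
Hypothesis Rlocal : local_with_maximal_ideal m.
Hypothesis Rdim1 : has_krull_dim R 1.

(** Otherwise 0 < P < m would be a prime chain of length 2. *)
Lemma nonzero_prime_max (P : R -> Prop) : is_ideal P -> ~ P 1 ->
  (forall a b, P (a * b) -> P a \/ P b) -> (exists z, z != 0 /\ P z) ->
  forall z, z \in m -> P z.
Proof.
move=> Pid P1 Pprime [w [w0 Pw]] z zm; apply: contrapT => Pz.
have [O OE] := zero_prime_idealr R.
have [Q QE] : exists Q : prime_idealr R, forall z, z \in Q <-> P z.
  have [J JE] := is_ideal_idealr Pid P1.
  have [|K KE] := @prime_idealr_of _ J; last by exists K => y; rewrite KE.
  by move=> u v /JE /Pprime[] /JE ->; rewrite ?orbT.
have [M ME] := prime_idealr_of (local_prime Rnoeth Rlocal).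
pose C (i : 'I_3) := nth O [:: O; Q; M] i.
suff /(Rdim1.2 2%N) : prime_chain C by [].
have sQM y : y \in Q -> y \in M.
  by move=> /QE Py; rewrite ME; exact: (local_sub Rnoeth Rlocal Pid).
have sOQ y : y \in O -> y \in Q by move=> /OE ->; apply/rpred0.
move=> [[|[|[|i]]] Hi] // [[|[|[|j]]] Hj] //= _; rewrite /C /=; split=> //.
- by exists w; [exact/QE | apply/negP => /OE /eqP; apply/negP].
- by move=> y /sOQ/sQM.
- by exists w; [exact/sQM/QE | apply/negP => /OE /eqP; apply/negP].
- by exists z; [rewrite ME | apply/negP => /QE].
Qed.

(* An ideal maximal among the nonzero ideals violating [Phi] would be prime,  *)
(* hence equal to [m].                                                         *)
Lemma nonzero_ideal_ind (Phi : (R -> Prop) -> Prop) :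
  (forall I, is_ideal I -> I 1 -> Phi I) ->
  (forall I, is_ideal I -> ~ I 1 -> (forall z, z \in m -> I z) -> Phi I) ->
  (forall I a b, is_ideal I -> I (a * b) -> ~ I a -> ~ I b ->
     (forall J, is_ideal J -> (forall z, I z -> J z) ->
        (exists z, J z /\ ~ I z) -> Phi J) -> Phi I) ->
  forall I, is_ideal I -> (exists z, z != 0 /\ I z) -> Phi I.
Proof.
move=> Phi1 Phim Phiab I Iid In0; apply: contrapT => PhiI.
pose F J := [/\ is_ideal J, exists z, z != 0 /\ J z & ~ Phi J].
have [||M [Mid Mn0 PhiM] Mmax] := @noetherian_max R F Rnoeth.
- by move=> J [].
- by exists I.
apply: PhiM; have [/Phi1|M1] := pselect (M 1); first exact.
have [Mprime|] := pselect (forall a b, M (a * b) -> M a \/ M b).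
  by apply: Phim => //; exact: nonzero_prime_max.
move=> /existsNP[a /existsNP[b /not_implyP[Mab /not_orP[Ma Mb]]]].
apply: (Phiab _ a b) => // J Jid MJ [z [Jz Mz]]; apply: contrapT => PhiJ.
apply/Mz/(Mmax J) => //; split=> //.
by have [y [y0 My]] := Mn0; exists y; split=> //; exact: MJ.
Qed.

(** R / I is artinian. If ab is in I but a and b are not, the chains J_n + (a) and (J_n : a) contain
    the strictly larger ideals I + (a) and (I : a), so both become stationary; nested ideals with
    equal sums with (a) and equal colons by a coincide. *)
Lemma artinian (I : R -> Prop) (J : nat -> R -> Prop) :
  is_ideal I -> (exists z, z != 0 /\ I z) ->
  (forall n, is_ideal (J n)) -> (forall n z, J n.+1 z -> J n z) ->
  (forall n z, I z -> J n z) ->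
  exists n, forall k z, (n <= k)%N -> J n z -> J k z.
Proof.
move=> Iid In0; move: I Iid In0 J.
apply: nonzero_ideal_ind => [I Iid I1|I Iid I1 Im|I a b Iid Iab Ia Ib IH] J Jid Jdec IJ.
- exists 0%N => k z _ _; rewrite -[z]mulr1.
  by apply: is_idealM => //; exact: IJ.
- have [Jall|/existsNP[n Jn]] := pselect (forall n, J n 1).
    by exists 0%N => k z _ _; rewrite -[z]mulr1; exact: is_idealM.
  exists n => k z _ /(local_sub Rnoeth Rlocal (Jid n) Jn) zm.
  exact/IJ/Im.
have Jle n k z : (n <= k)%N -> J k z -> J n z.
  by move=> /subnK <-; elim: (k - n)%N => // l IHl /Jdec.
have [||||||n1 H1] := IH (add_principal I a) _ _ _ (fun n => add_principal (J n) a).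
- exact: add_principal_ideal.
- exact: sub_add_principal.
- by exists a; split=> //; exact: mem_add_principal.
- by move=> n; exact: add_principal_ideal.
- by move=> n _ [u [r [/Jdec Ju ->]]]; exists u, r.
- by move=> n _ [u [r [/(IJ n) Ju ->]]]; exists u, r.
have [||||||n2 H2] := IH (fun z => I (z * a)) _ _ _ (fun n z => J n (z * a)).
- exact: colon_ideal.
- by move=> z Iz; rewrite mulrC; exact: is_idealM.
- by exists b; split=> //; rewrite mulrC.
- by move=> n; exact: colon_ideal.
- by move=> n z; exact: Jdec.
- by move=> n z; exact: IJ.
exists (maxn n1 n2) => k z; rewrite geq_max => /andP[k1 k2] Jz.
have [u [r [Ju zE]]] : add_principal (J k) a z.
  by apply/(H1 _ _ k1)/sub_add_principal/Jle/Jz; rewrite leq_maxl.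
rewrite zE; apply: is_idealD => //; apply: (H2 _ _ k2).
apply: (Jle _ (maxn n1 n2)); first by rewrite leq_maxr.
have -> : r * a = z - u by rewrite zE; ring.
by apply: is_idealB => //; apply/Jle/Ju; rewrite geq_max k1.
Qed.

(** This is the inclusion of I^(n+k) in I^n I^k, tested against an ideal J; the induction on n
    replaces J by the colon ideals (J : c) with c in I. *)
Lemma ideal_exp_addn (A : comNzRingType) (I : {pred A}) (J : A -> Prop) n k :
  is_ideal J ->
  (forall u v, u \in ideal_exp I n -> v \in ideal_exp I k -> J (u * v)) ->
  forall z, z \in ideal_exp I (n + k) -> J z.
Proof.
elim: n J => [|n IHn] J Jid JM z zI.
  by rewrite -[z]mul1r; exact: JM.
have /asboolP[s [sP ->]] := zI.
rewrite big_seq; apply: (big_ind J) => [|a b|p /sP[p1 p2]].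
- exact: is_ideal0.
- exact: is_idealD.
rewrite mulrC; apply: (IHn (fun w => J (w * p.1))) p2; first exact: colon_ideal.
move=> u v un vk; rewrite mulrAC; apply: JM => //.
apply/asboolP; exists [:: (p.1, u)]; rewrite big_seq1 mulrC; split=> //.
by move=> q; rewrite inE => /eqP->.
Qed.

(** When ab is in I, the product of I + (a) and I + (b) lies in I, so the exponents found for these
    two ideals add up. *)
Lemma ideal_exp_sub (I : R -> Prop) : is_ideal I -> (exists z, z != 0 /\ I z) ->
  exists n, forall z, z \in ideal_exp m n -> I z.
Proof.
move: I; apply: nonzero_ideal_ind => [I Iid I1|I Iid I1 Im|I a b Iid Iab Ia Ib IH].
- by exists 0%N => z _; rewrite -[z]mulr1; exact: is_idealM.
- exists 1%N => z /asboolP[s [sP ->]]; rewrite big_seq; apply: (big_ind I).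
  + exact: is_ideal0.
  + exact: is_idealD.
  by move=> p /sP[p1 _]; rewrite mulrC; apply: is_idealM => //; exact: Im.
have H c : ~ I c -> exists n, forall z, z \in ideal_exp m n -> add_principal I c z.
  move=> Ic; apply: IH; first exact: add_principal_ideal.
    exact: sub_add_principal.
  by exists c; split=> //; exact: mem_add_principal.
have [n nP] := H a Ia; have [k kP] := H b Ib.
exists (n + k)%N; apply: ideal_exp_addn => // _ _ /nP[u [r [Iu ->]]] /kP[v [t [Iv ->]]].
have -> : (u + r * a) * (v + t * b) =
    (v + t * b) * u + (r * a) * v + (r * t) * (a * b) by ring.
by apply: is_idealD => //; [apply: is_idealD => //|]; exact: is_idealM.
Qed.

End DimensionOne.

(** * Algebras complete along an element x *)

Section CompleteAlgebra.
Variables (R : comNzRingType) (S : comAlgType R) (x : R).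

(** The properties of an x-adic completion of R used below: S is x-torsion-free and x-adically
    separated, R maps onto S / xS, power series in x over R converge, and R / x^n R embeds into S /
    x^n S. *)
Record complete_along : Prop := CompleteAlong {
  complete_reg : forall s : S, x *: s = 0 -> s = 0;
  complete_sep : forall s : S, (forall n, exists t, s = x ^+ n *: t) -> s = 0;
  complete_dec : forall s : S, exists r t, s = r%:A + x *: t;
  complete_sum : forall c : nat -> R, exists s : S, forall n, exists t,
    s = (\sum_(i < n) c i * x ^+ i)%:A + x ^+ n *: t;
  complete_pure : forall n r (t : S), r%:A = x ^+ n *: t -> exists c, r = x ^+ n * c }.

Hypothesis Rnoeth : noetherian R.
Hypothesis Sx : complete_along.
Hypothesis Rx_artinian : forall J : nat -> R -> Prop,
  (forall n, is_ideal (J n)) -> (forall n z, J n.+1 z -> J n z) ->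
  (forall n, J n x) -> exists n, forall k z, (n <= k)%N -> J n z -> J k z.

Definition saturated (J : S -> Prop) := forall t, J (x *: t) -> J t.

Lemma is_idealZ (J : S -> Prop) a s : is_ideal J -> J s -> J (a *: s).
Proof. by move=> Jid Js; rewrite -mulr_algl; exact: is_idealM. Qed.

Lemma complete_regX n (s t : S) : x ^+ n *: s = x ^+ n *: t -> s = t.
Proof.
move/eqP; rewrite -subr_eq0 -scalerBr => /eqP st.
apply/eqP; rewrite -subr_eq0; apply/eqP; move: (s - t) st => {s t} s.
elim: n => [|n IHn]; first by rewrite scale1r.
by rewrite exprS -scalerA => /(complete_reg Sx)/IHn.
Qed.

(* Successive approximation. *)
Lemma generators_mod (J : S -> Prop) (g : seq S) :
  is_ideal J -> saturated J -> (forall i, (i < size g)%N -> J g`_i) ->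
  (forall z, J z -> exists (c : nat -> R) t, z = \sum_(i < size g) c i *: g`_i + x *: t) ->
  forall z, J z -> exists C : nat -> S, z = \sum_(i < size g) C i * g`_i.
Proof.
move=> Jid Jsat Jg gen z0 Jz0.
have step (z : {z | J z}) : exists ct : (nat -> R) * {z | J z},
    sval z = \sum_(i < size g) ct.1 i *: g`_i + x *: sval ct.2.
  case: z => z Jz /=; have [c [t zE]] := gen z Jz.
  suff Jt : J t by exists (c, exist _ t Jt).
  apply: Jsat; have -> : x *: t = z - \sum_(i < size g) c i *: g`_i.
    by rewrite zE addrC addKr.
  apply: is_idealB => //; apply: (@is_ideal_sum _ _ _ (fun i => c i *: g`_i)) => // i /Jg.
  exact: is_idealZ.
have [next nextP] := choice step.
pose z_ n := iter n (fun z => (next z).2) (exist _ z0 Jz0).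
pose c_ i n := (next (z_ n)).1 i.
(* C i is the x-adic sum of the coefficients that the i-th generator receives in the successive
   steps. *)
have [C CP] := choice (fun i => complete_sum Sx (c_ i)).
exists C; apply/eqP; rewrite -subr_eq0; apply/eqP/(complete_sep Sx) => n.
have [T TP] := choice (fun i => CP i n).
exists (sval (z_ n) - \sum_(i < size g) T i * g`_i).
have z0E : z0 = \sum_(i < size g) (\sum_(k < n) c_ i k * x ^+ k) *: g`_i +
    x ^+ n *: sval (z_ n).
  elim: {T TP} n => [|n IHn].
    by rewrite expr0 scale1r big1 ?add0r // => i _; rewrite big_ord0 scale0r.
  rewrite IHn (nextP (z_ n)) scalerDr addrA scalerA -exprSr; congr (_ + _).
  rewrite scaler_sumr -big_split /=; apply: eq_bigr => i _.
  by rewrite scalerA -scalerDl big_ord_recr /= [x ^+ n * _]mulrC.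
rewrite {1}z0E scalerBr addrAC addrC; congr (_ + _).
rewrite scaler_sumr -!sumrN -big_split /=; apply: eq_bigr => i _.
by rewrite {1}(TP i) mulrDl mulr_algl opprD addrA subrr add0r scalerAl.
Qed.

(** Modulo x, J is described by the ideal L of those r in R congruent to an element of J; generators
    of L lift to J. *)
Lemma finite_generators_mod (J : S -> Prop) : is_ideal J ->
  exists g : seq S, (forall i, (i < size g)%N -> J g`_i) /\
  forall z, J z -> exists (c : nat -> R) t, z = \sum_(i < size g) c i *: g`_i + x *: t.
Proof.
move=> Jid; pose L r := exists z t, J z /\ z = r%:A + x *: t.
have Lid : is_ideal L.
  split.
  - by exists 0, 0; split; [exact: is_ideal0 | rewrite scale0r scaler0 addr0].
  - move=> a b [z [t [Jz zE]]] [w [u [Jw wE]]]; exists (z + w), (t + u).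
    by split; [exact: is_idealD | rewrite zE wE scalerDl scalerDr addrACA].
  - move=> a b [z [t [Jz zE]]]; exists (a *: z), (a *: t).
    split; first exact: is_idealZ.
    by rewrite zE scalerDr !scalerA mulrC [x * a]mulrC.
have [l [lL lgen]] := noetherian_fg Rnoeth Lid.
have lift i : exists w : S * S,
    (i < size l)%N -> J w.1 /\ w.1 = (l`_i)%:A + x *: w.2.
  have [il|il] := boolP (i < size l)%N; last by exists 0.
  by have [z [t [Jz zE]]] := lL i il; exists (z, t).
have [w wP] := choice lift.
have gE i : (i < size l)%N -> (mkseq (fun i => (w i).1) (size l))`_i = (w i).1 by exact: nth_mkseq.
exists (mkseq (fun i => (w i).1) (size l)); rewrite size_mkseq; split=> [i il|z Jz].
  by rewrite gE //; exact: (wP i il).1.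
have [r [t zE]] := complete_dec Sx z.
have [|c rE] := lgen r; first by exists z, t.
exists c, (t - \sum_(i < size l) c i *: (w i).2).
rewrite zE rE scalerBr addrA addrAC; congr (_ + _).
rewrite scaler_suml scaler_sumr -sumrN -big_split /=; apply: eq_bigr => i _.
rewrite gE // (wP i _).2 // scalerDr [c i *: (x *: _)]scalerA.
by rewrite [x *: (c i *: _)]scalerA [x * _]mulrC addrK scalerA.
Qed.

(** A form of Nakayama's lemma: generators of I modulo x also generate J modulo x, hence generate J
    outright by [generators_mod]. *)
Lemma saturated_sub (I J : S -> Prop) : is_ideal I -> is_ideal J -> saturated J ->
  (forall z, I z -> J z) ->
  (forall z, J z -> exists w t, I w /\ z = w + x *: t) -> forall z, J z -> I z.
Proof.
move=> Iid Jid Jsat IJ JI z Jz.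
have [g [gI ggen]] := finite_generators_mod Iid.
have gJ i : (i < size g)%N -> J g`_i by move=> /gI/IJ.
have [w Jw|C ->] := generators_mod Jid Jsat gJ _ Jz.
  have [u [t [Iu ->]]] := JI w Jw; have [c [t' ->]] := ggen u Iu.
  by exists c, (t' + t); rewrite scalerDr addrA.
apply: (@is_ideal_sum _ _ _ (fun i => C i * g`_i)) => // i /gI; exact: is_idealM.
Qed.

(** J n is the x-saturation of (a^n). Its trace L n modulo x is a decreasing chain of ideals of R
    containing x, so it is stationary, and [saturated_sub] lifts one equality back to S. *)
Lemma power_stable (a : S) : exists n l c, x ^+ l *: a ^+ n = a ^+ n.+1 * c.
Proof.
pose J n z := exists l c, x ^+ l *: z = a ^+ n * c.
have Jid n : is_ideal (J n).
  split.
  - by exists 0%N, 0; rewrite scaler0 mulr0.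
  - move=> z w [l [c zE]] [k [e wE]]; exists (l + k)%N, (x ^+ k *: c + x ^+ l *: e).
    rewrite mulrDr -!scalerAr -zE -wE !scalerA -!exprD scalerDr.
    by rewrite [(k + l)%N]addnC.
  - by move=> b z [l [c zE]]; exists l, (b * c); rewrite scalerAr zE mulrCA.
have Jsat n : saturated (J n).
  by move=> t [l [c E]]; exists l.+1, c; rewrite exprSr -scalerA.
have Jdec n z : J n.+1 z -> J n z.
  by move=> [l [c E]]; exists l, (a * c); rewrite E exprSr mulrA.
pose L n r := exists z t, J n z /\ z = r%:A + x *: t.
have [|||n nP] := @Rx_artinian L.
- move=> n; split.
  + by exists 0, 0; split; [exact: is_ideal0 | rewrite scale0r scaler0 addr0].
  + move=> b c [z [t [Jz zE]]] [w [u [Jw wE]]]; exists (z + w), (t + u).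
    by split; [exact: is_idealD | rewrite zE wE scalerDl scalerDr addrACA].
  + move=> b c [z [t [Jz zE]]]; exists (b *: z), (b *: t).
    split; first exact: is_idealZ.
    by rewrite zE scalerDr !scalerA mulrC [x * b]mulrC.
- by move=> n r [z [t [/Jdec Jz zE]]]; exists z, t.
- move=> n; exists 0, (-1); split; first exact: is_ideal0.
  by rewrite scalerN subrr.
suff [l [c E]] : J n.+1 (a ^+ n) by exists n, l, c.
have Jn : J n (a ^+ n) by exists 0%N, 1; rewrite scale1r mulr1.
apply: (saturated_sub (Jid n.+1) (Jid n) (Jsat n)) Jn => [|z Jz]; first exact: Jdec.
have [r [t zE]] := complete_dec Sx z.
have [|w [u [Jw wE]]] := nP n.+1 r (leqnSn n); first by exists z, t.
by exists w, (t - u); split=> //; rewrite zE wE scalerBr addrA addrAC addrK.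
Qed.

(** One element at a time: multiply y by the last power of a that does not annihilate it. The
    remaining elements still act nilpotently. *)
Lemma nilpotent_killer (g : seq S) (y : S) : y != 0 ->
  (forall a, a \in g -> exists n, a ^+ n * y = 0) ->
  exists b, b * y != 0 /\ forall a, a \in g -> a * (b * y) = 0.
Proof.
elim: g y => [|a g IHg] y y0 gy; first by exists 1; rewrite mul1r.
have [n an] := gy a (mem_head a g).
have [k] : exists k, (a ^+ k * y != 0) && (a ^+ k.+1 * y == 0).
  elim: n an => [|n IHn] an; first by rewrite mul1r in an; rewrite an eqxx in y0.
  by have [/IHn //|any] := eqVneq (a ^+ n * y) 0; exists n; rewrite any an eqxx.
move=> /andP[aky /eqP aky1].
have [c cg|b [b0 bP]] := IHg _ aky.
  have [j cj] := gy c (mem_behead (s := a :: g) cg).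
  by exists j; rewrite mulrCA cj mulr0.
exists (b * a ^+ k); rewrite -mulrA; split=> // c.
rewrite inE => /orP[/eqP->|/bP //].
by rewrite mulrCA [a * _]mulrA -exprS aky1 mulr0.
Qed.

(** For a in p, [power_stable] gives a^n (x^l - a c) = 0, with the second factor outside p. The
    product of these factors over generators of p is outside p, hence nonzero, and
    [nilpotent_killer] applies to it. *)
Lemma prime_annihilator (p : S -> Prop) : is_ideal p ->
  (forall a b, p (a * b) -> p a \/ p b) -> ~ p x%:A ->
  exists2 y : S, y != 0 & forall z, p z -> z * y = 0.
Proof.
move=> pid pprime px.
have p1 : ~ p 1 by rewrite -[1]scale1r => /(is_idealZ x pid); rewrite scalerA mulr1.
have psat : saturated p.
  by move=> t; rewrite -mulr_algl => /pprime[].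
have [g [gp ggen]] := finite_generators_mod pid.
have nil a : p a -> exists n c, ~ p c /\ a ^+ n * c = 0.
  move=> pa; have [n [l [c E]]] := power_stable a.
  exists n, ((x ^+ l)%:A - a * c); split; last first.
    by rewrite mulrBr -scalerAr mulr1 E exprSr mulrA subrr.
  move=> pxl; have {}pxl : p (x ^+ l)%:A.
    rewrite -[_%:A](subrK (a * c)); apply: (is_idealD pid) pxl _.
    by rewrite mulrC; exact: is_idealM.
  elim: l {E} pxl => [|l IHl]; first by rewrite scale1r.
  by rewrite exprS -scalerA => /psat.
have : exists2 c, ~ p c & forall a, a \in g -> exists n, a ^+ n * c = 0.
  have : forall a, a \in g -> p a by move=> a /(nthP 0)[i /gp ? <-].
  elim: (g) => [|a h IHh] hp; first by exists 1.
  have [b bh|c pc cP] := IHh; first by apply: hp; rewrite inE bh orbT.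
  have [n [e [pe eP]]] := nil a (hp a (mem_head a h)).
  exists (c * e); first by move=> /pprime[].
  move=> b; rewrite inE => /orP[/eqP->|/cP[k bk]].
    by exists n; rewrite mulrCA eP mulr0.
  by exists k; rewrite mulrA bk mul0r.
move=> [c pc]; have c0 : c != 0.
  by apply: contra_notN pc => /eqP->; exact: is_ideal0.
move=> cP; have [b [b0 bP]] := nilpotent_killer c0 cP.
exists (b * c) => // z pz; have [C ->] := generators_mod pid psat gp ggen pz.
rewrite mulr_suml big1 // => i _; rewrite -mulrA bP ?mulr0 //.
exact: mem_nth.
Qed.

(** An ideal p maximal among those containing K and no power of x is prime: for a and b outside p, p
    + (a) and p + (b) contain some x^k and x^l, so ab in p would force x^(k+l) into p. *)
Lemma prime_avoiding (K : S -> Prop) : is_ideal K -> (forall l, ~ K (x ^+ l)%:A) ->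
  exists p : S -> Prop, [/\ is_ideal p, forall a b, p (a * b) -> p a \/ p b,
    ~ p x%:A & forall z, K z -> p z].
Proof.
move=> Kid Kx.
(* [Zorn_bigcup] also demands the property of the empty chain, whence the     *)
(* union with [K].                                                            *)
pose P (X : set S) := is_ideal (K `|` X)%classic /\ forall l, ~ (K `|` X)%classic (x ^+ l)%:A.
have [F FP Ftot|X [[pid px] Xmax]] := @Zorn_bigcup S P.
  split=> [|l [/Kx //|[X /FP[_ +] Xl]]]; last by move=> /(_ l); apply; right.
  split; first by left; exact: is_ideal0.
    move=> a b [Ka|[X FX Xa]] [Kb|[Y FY Yb]].
    - by left; exact: is_idealD.
    - have [||Kab|Yab] := is_idealD (FP _ FY).1 (a := a) (b := b);
        [by left|by right|by left|].
      by right; exists Y.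
    - have [||Kab|Yab] := is_idealD (FP _ FX).1 (a := a) (b := b);
        [by right|by left|by left|].
      by right; exists X.
    - have [Z [FZ Za Zb]] : exists Z, [/\ F Z, Z a & Z b].
        by case: (Ftot X Y FX FY) => [/(_ _ Xa)|/(_ _ Yb)]; [exists Y|exists X].
      have [||Kab|Zab] := is_idealD (FP _ FZ).1 (a := a) (b := b);
        [by right|by right|by left|].
      by right; exists Z.
  move=> a b [Kb|[X FX Xb]]; first by left; exact: is_idealM.
  have [|Kab|Xab] := is_idealM (FP _ FX).1 a (b := b); [by right|by left|].
  by right; exists X.
set p := (K `|` X)%classic in pid px.
have hits c : ~ p c -> exists l, add_principal p c (x ^+ l)%:A.
  move=> pc; apply: contrapT => /forallNP nol.
  apply: (Xmax (add_principal p c)).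
    split; first by move=> z Xz; apply: sub_add_principal; right.
    by move=> /(_ c (mem_add_principal c pid)) Xc; apply: pc; right.
  have -> : P (add_principal p c) =
      (is_ideal (add_principal p c) /\ forall l, ~ add_principal p c (x ^+ l)%:A).
    rewrite /P; suff -> : (K `|` add_principal p c)%classic = add_principal p c by [].
    by apply/setUidPr => z Kz; apply: sub_add_principal; left.
  by split=> //; exact: add_principal_ideal.
exists p; split=> // [a b pab||]; last by left.
- apply: contrapT => /not_orP[/hits[k [u [r [pu kE]]]] /hits[l [v [t [pv lE]]]]].
  apply: (px (k + l)%N).
  have -> : (x ^+ (k + l))%:A = (x ^+ k)%:A * (x ^+ l)%:A :> S.
    by rewrite -scalerAl mul1r scalerA exprD.
  rewrite kE lE.
  have -> : (u + r * a) * (v + t * b) =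
      (v + t * b) * u + (r * a) * v + (r * t) * (a * b) by ring.
  by apply: is_idealD => //; [apply: is_idealD => //|]; exact: is_idealM.
- by have := px 1%N.
Qed.

End CompleteAlgebra.

(** * A multiplier carrying W = R + x W into S *)

Section FractionSubmodule.
Variables (R : idomainType) (S : comAlgType R) (x : R).
Hypothesis x0 : x != 0.
Hypothesis Rnoeth : noetherian R.
Hypothesis Sx : complete_along S x.
Hypothesis Rx_artinian : forall J : nat -> R -> Prop,
  (forall n, is_ideal (J n)) -> (forall n z, J n.+1 z -> J n z) ->
  (forall n, J n x) -> exists n, forall k z, (n <= k)%N -> J n z -> J k z.

Local Notation "r %:F" := (FracField.tofrac r).

Lemma tofracX_neq0 n : x%:F ^+ n != 0.
Proof. by rewrite expf_neq0 // tofrac_eq0. Qed.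

Lemma divisible_multiplier (W : {fraction R} -> Prop) :
  W 1 -> (forall p q, W p -> W q -> W (p + q)) ->
  (forall r q, W q -> W (r%:F * q)) ->
  (forall q, W q -> exists r p, W p /\ q = r%:F + x%:F * p) ->
  (exists n, ~ W (x%:F ^- n)) ->
  exists2 y : S, y != 0 &
    forall k r, W (r%:F / x%:F ^+ k) -> exists s, r *: y = x ^+ k *: s.
Proof.
move=> W1 WD WZ Wdiv [n0 Wn0].
have WR r : W r%:F by rewrite -[r%:F]mulr1; exact: WZ.
(* When Q = R[1/x], K is the annihilator of Q / W: s acts on the class of 1 / x^n as any r congruent
   to it modulo x^n. *)
pose K (s : S) := forall n, exists r t, W (r%:F / x%:F ^+ n) /\ s = r%:A + x ^+ n *: t.
have Kid : is_ideal K.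
  split.
  - by move=> n; exists 0, 0; rewrite scale0r scaler0 addr0 tofrac0 mul0r -(tofrac0 R).
  - move=> a b Ka Kb n; have [r [t [Wr ->]]] := Ka n; have [u [v [Wu ->]]] := Kb n.
    exists (r + u), (t + v); rewrite tofracD mulrDl scalerDl scalerDr addrACA.
    by split=> //; exact: WD.
  - move=> a b Kb n; have [r [t [Wr ->]]] := Kb n.
    have [c [v ->]] : exists c v, a = c%:A + x ^+ n *: v.
      have [c [v ->]] : exists c v, a = c%:A + x ^+ n *: v; last by exists c, v.
      elim: n {t Wr r} => [|n [c [v ->]]]; first by exists 0, a; rewrite scale0r scale1r add0r.
      have [d [w ->]] := complete_dec Sx v.
      exists (c + x ^+ n * d), w.
      by rewrite scalerDl scalerDr !scalerA exprSr addrA.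
    exists (c * r), (v * (r%:A + x ^+ n *: t) + c *: t); split.
      by rewrite tofracM -mulrA; exact: WZ.
    rewrite mulrDl mulr_algl scalerDr scalerA -addrA; congr (_ + _).
    by rewrite scalerDr scalerAl !scalerA [c * _]mulrC addrC.
have Kx l : ~ K (x ^+ l)%:A.
  (* By purity x^l - r = x^(n0+l) c in R; dividing by x^(n0+l) puts 1 / x^n0 in W. *)
  move=> /(_ (n0 + l)%N)[r [t [Wr E]]]; apply: Wn0.
  have [|c cE] := complete_pure Sx (n := (n0 + l)%N) (r := x ^+ l - r) (t := t).
    by rewrite scalerBl E addrC addKr.
  have -> : x%:F ^- n0 = c%:F + r%:F / x%:F ^+ (n0 + l).
    apply: (mulIf (tofracX_neq0 (n0 + l))).
    rewrite mulrDl divfK ?tofracX_neq0 // [c%:F * _]mulrC -!tofracXn -tofracM.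
    rewrite -cE -tofracD subrK exprD tofracM mulrA mulVf ?mul1r //.
    by rewrite tofracXn tofracX_neq0.
  exact: WD.
have [p [pid pprime px Kp]] := prime_avoiding Kid Kx.
have [y y0 yp] := prime_annihilator Rnoeth Sx Rx_artinian pid pprime px.
exists y => // k r Wr.
have step (q : {q | W q}) : exists cq : R * {q | W q}, sval q = cq.1%:F + x%:F * sval cq.2.
  by case: q => q /= /Wdiv[c [q' [Wq' qE]]]; exists (c, exist _ q' Wq').
have [next nextP] := choice step.
pose w_ n := iter n (fun q => (next q).2) (exist _ _ Wr).
pose c_ n := (next (w_ n)).1.
have wE n : r%:F / x%:F ^+ k = (\sum_(i < n) c_ i * x ^+ i)%:F + x%:F ^+ n * sval (w_ n).
  elim: n => [|n IHn]; first by rewrite big_ord0 tofrac0 add0r mul1r.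
  rewrite IHn (nextP (w_ n)) big_ord_recr /= tofracD tofracM tofracXn mulrDr exprSr.
  by rewrite mulrA addrA [x%:F ^+ n * _]mulrC.
have [s sP] := complete_sum Sx c_.
(* Here s is the sum of the x-adic expansion of r / x^k. Cutting it at n leaves x^n w_n with w_n in
   W, so the approximation of r - x^k s divided by x^n is x^k w_n. *)
suff Kr : K (r%:A - x ^+ k *: s).
  exists (s * y); apply/eqP; rewrite -subr_eq0 -mulr_algl scalerAl -mulrBl.
  by apply/eqP/yp/Kp.
move=> n; have [t tE] := sP n.
exists (r - x ^+ k * \sum_(i < n) c_ i * x ^+ i), (- (x ^+ k *: t)); split; last first.
  by rewrite tE scalerDr scalerBl !scalerA scalerN scalerA [x ^+ n * _]mulrC opprD addrA.
have -> : (r - x ^+ k * \sum_(i < n) c_ i * x ^+ i)%:F / x%:F ^+ n =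
    (x ^+ k)%:F * sval (w_ n).
  apply: (mulIf (tofracX_neq0 n)); rewrite divfK ?tofracX_neq0 //.
  rewrite tofracB tofracM -{1}[r%:F](divfK (tofracX_neq0 k)) (wE n) -!tofracXn.
  by ring.
by apply: WZ; exact: svalP.
Qed.

End FractionSubmodule.

(** * The algebra structure of the adic completion *)

Section CompletionAlgebra.
Variables (R : comNzRingType) (I : idealr R).

Lemma coherent1 : coherent (fun n => 1 : {ideal_quot pos_power I n}).
Proof.
apply/coherentP; exists (fun=> 1); split=> n; last by rewrite subrr rpred0.
by rewrite proj1.
Qed.

Lemma coherentM (x y : quot_family I) :
  coherent x -> coherent y -> coherent (fun n => x n * y n).
Proof.
move=> /coherentP[r [xr rP]] /coherentP[t [yt tP]]; apply/coherentP.
exists (fun n => r n * t n); split=> n; first by rewrite xr yt projM.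
have -> : r n.+1 * t n.+1 - r n * t n =
  r n.+1 * (t n.+1 - t n) + t n * (r n.+1 - r n) by ring.
by rewrite rpredD ?idealMr.
Qed.

Definition ac_one := mk_ac coherent1.
Definition ac_mul (x y : adic_completion I) := mk_ac (coherentM (ac_cohP x) (ac_cohP y)).

Lemma ac_mulA : associative ac_mul.
Proof. by move=> x y z; apply: ac_ext => n /=; rewrite mulrA. Qed.

Lemma ac_mulC : commutative ac_mul.
Proof. by move=> x y; apply: ac_ext => n /=; rewrite mulrC. Qed.

Lemma ac_mul1 : left_id ac_one ac_mul.
Proof. by move=> x; apply: ac_ext => n /=; rewrite mul1r. Qed.

Lemma ac_mulDl : left_distributive ac_mul +%R.
Proof. by move=> x y z; apply: ac_ext => n /=; rewrite mulrDl. Qed.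

Lemma ac_one_neq0 : ac_one != 0.
Proof. by apply/eqP => /(congr1 (fun s => ac_val s 0%N)) /= /eqP; rewrite oner_eq0. Qed.

HB.instance Definition _ := GRing.Zmodule_isComNzRing.Build (adic_completion I)
  ac_mulA ac_mulC ac_mul1 ac_mulDl ac_one_neq0.

Lemma ac_scaleAl (a : R) (x y : adic_completion I) : a *: (x * y) = (a *: x) * y.
Proof. by apply: ac_ext => n /=; rewrite mulrA. Qed.

HB.instance Definition _ :=
  GRing.Lmodule_isLalgebra.Build R (adic_completion I) ac_scaleAl.

HB.instance Definition _ := GRing.Lalgebra_isComAlgebra.Build R (adic_completion I).

Lemma ac_val0 n : ac_val (0 : adic_completion I) n = 0.
Proof. by []. Qed.

Lemma ac_valD (s t : adic_completion I) n : ac_val (s + t) n = ac_val s n + ac_val t n.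
Proof. by []. Qed.

Lemma ac_valZ a (s : adic_completion I) n : ac_val (a *: s) n = proj I n a * ac_val s n.
Proof. by []. Qed.

Lemma ac_valA a n : ac_val (a%:A : adic_completion I) n = proj I n a.
Proof. by rewrite ac_valZ /= mulr1. Qed.

Lemma ac_repr (s : adic_completion I) : exists r : nat -> R,
  (forall n, ac_val s n = proj I n (r n)) /\
  forall n k, (n <= k)%N -> r k - r n \in pos_power I n.
Proof.
have /coherentP[r [sr rP]] := ac_cohP s; exists r; split=> // n k /subnKC <-.
elim: (k - n)%N => [|j IHj]; first by rewrite addn0 subrr rpred0.
rewrite -[_ - _](subrKA (r (n + j)%N)) rpredD // addnS.
have mono i l z : z \in pos_power I (i + l)%N -> z \in pos_power I i.
  by elim: l => [|l IHl]; rewrite ?addn0 // addnS => /pos_powerSS/IHl.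
exact/mono/rP.
Qed.

Lemma idealr_pow x n : x \in I -> x ^+ n.+1 \in pos_power I n.
Proof.
move=> xI; have : x ^+ n.+1 \in ideal_exp I n.+1; last by [].
elim: n.+1 => // k IHk; apply/asboolP; exists [:: (x, x ^+ k)].
by rewrite big_seq1 exprS; split=> // p; rewrite inE => /eqP->.
Qed.

Lemma proj_pow0 x n k : x \in I -> (n < k)%N -> proj I n (x ^+ k) = 0.
Proof.
move=> xI nk; rewrite -(proj0 I n); apply/eq_projP; rewrite subr0.
by rewrite -(subnK nk) exprD idealMr // idealr_pow.
Qed.

Lemma ac_separated x (s : adic_completion I) : x \in I ->
  (forall n, exists t, s = x ^+ n *: t) -> s = 0.
Proof.
move=> xI sx; apply: ac_ext => n; have [t ->] := sx n.+1.
by rewrite ac_valZ proj_pow0 // mul0r.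
Qed.

End CompletionAlgebra.

(** * The m-adic completion as an x-adic one, when the two topologies agree *)

Section CompletionAlong.
Variables (R : idomainType) (m : idealr R) (x : R).
Hypothesis xm : x \in m.
Hypothesis x0 : x != 0.
Hypothesis mx : forall k, exists n, forall z, z \in ideal_exp m n -> exists c, z = x ^+ k * c.

Lemma pos_power_sub k : exists n, forall i z, (n <= i)%N ->
  z \in pos_power m i -> exists c, z = x ^+ k * c.
Proof.
have [n nP] := mx k; exists n => i z ni zi; apply: nP.
have {ni} -> : n = (i.+1 - (i.+1 - n))%N by rewrite subKn // ltnW.
move: zi; change (z \in pos_power m i) with (z \in ideal_exp m i.+1).
elim: (i.+1 - n)%N => [|j IHj]; first by rewrite subn0.
move=> /IHj; rewrite subnS; case: (i.+1 - j)%N => [|[|l]] //.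
exact: pos_powerSS.
Qed.

Lemma adic_series (c : nat -> R) : exists s : adic_completion m,
  forall n, ac_val s n = proj m n (\sum_(i < n.+1) c i * x ^+ i).
Proof.
suff cP : coherent (fun n => proj m n (\sum_(i < n.+1) c i * x ^+ i)) by exists (mk_ac cP).
apply/coherentP; exists (fun n => \sum_(i < n.+1) c i * x ^+ i); split=> // n.
by rewrite [X in X - _]big_ord_recr addrAC subrr add0r; exact/idealMr/idealr_pow.
Qed.

Lemma adic_completion_along : complete_along (adic_completion m) x.
Proof.
split.
- move=> s xs; have [r [sr rP]] := ac_repr s; apply: ac_ext => n.
  (* Cancelling x from x^(n+2) leaves x^(n+1), which lies in [pos_power m n]. *)
  have [N NP] := pos_power_sub n.+2; pose k := maxn N n.
  rewrite sr ac_val0 -(proj0 m n); apply/eq_projP; rewrite subr0.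
  rewrite -(subKr (r k) (r n)) rpredB //; last by apply: rP; rewrite leq_maxr.
  have [||c] := NP k (x * r k); first by rewrite leq_maxl.
    rewrite -[_ * _]subr0; apply/eq_projP.
    by rewrite projM -sr -ac_valZ xs proj0.
  rewrite exprS -mulrA => /(mulfI x0) ->.
  by rewrite mulrC idealMr // idealr_pow.
- by move=> s; exact: ac_separated.
- move=> s; have [r [sr rP]] := ac_repr s.
  have [N NP] := choice pos_power_sub.
  (* M is nondecreasing with M k >= N k, so the k-th difference of r along M is divisible by x^k and
     s becomes a telescoping series. The summand k ensures M k >= k, for the final comparison with r
     n. *)
  pose M k := (k + \sum_(i < k.+1) N i)%N.
  have NM k : (N k <= M k)%N.
    by rewrite /M big_ord_recr addnA leq_addl.
  have MS k : (M k <= M k.+1)%N.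
    rewrite /M [in leqRHS]big_ord_recr /= addSnnS leq_add2l.
    by rewrite (leq_trans _ (leqnSn _)) // leq_addr.
  have d_ex k : exists d, r (M k.+1) - r (M k) = x ^+ k * d.
    exact: NP (NM k) (rP _ _ (MS k)).
  have [d dP] := choice d_ex.
  have [t tP] := adic_series (fun i => d i.+1).
  exists (r (M 1%N)), t; apply: ac_ext => n.
  rewrite ac_valD ac_valA ac_valZ tP -projM -projD sr; apply/eq_projP.
  have -> : r (M 1%N) + x * (\sum_(i < n.+1) d i.+1 * x ^+ i) = r (M n.+2).
    elim: n.+1 => [|j IHj]; first by rewrite big_ord0 mulr0 addr0.
    rewrite big_ord_recr /= mulrDr addrA IHj -[r (M j.+2)](subrK (r (M j.+1))) dP.
    by rewrite addrC [d _ * _]mulrC mulrA -exprS.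
  rewrite -rpredN opprB; apply: rP.
  by rewrite /M -addn2 -addnA leq_addr.
- move=> c; have [s sP] := adic_series c; exists s => n.
  (* In component k the two truncations differ only by terms of degree above k, which vanish modulo
     m^(k+1). *)
  have [t tP] := adic_series (fun i => c (n + i)%N).
  exists t; apply: ac_ext => k.
  rewrite ac_valD ac_valA ac_valZ sP tP -projM -projD; apply/eq_projP.
  rewrite mulr_sumr.
  have -> : \sum_(i < k.+1) x ^+ n * (c (n + i)%N * x ^+ i) =
      \sum_(i < k.+1) c (n + i)%N * x ^+ (n + i).
    by apply: eq_bigr => i _; rewrite mulrCA exprD.
  have E a b : \sum_(i < a + b) c i * x ^+ i =
      \sum_(i < a) c i * x ^+ i + \sum_(i < b) c (a + i)%N * x ^+ (a + i).
    by rewrite big_split_ord.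
  rewrite -E addnC E opprD addrA subrr add0r rpredN.
  rewrite rpred_sum // => i _; rewrite exprD mulrCA mulrC.
  exact/idealMr/idealr_pow.
- move=> n r t rt; have [u [tu _]] := ac_repr t.
  have [N NP] := pos_power_sub n.
  have [|c cE] := NP N (r - x ^+ n * u N) (leqnn N).
    by apply/eq_projP; rewrite -ac_valA rt ac_valZ tu projM.
  by exists (c + u N); rewrite mulrDr -cE subrK.
Qed.

End CompletionAlong.

Lemma scaled_div_add (K : fieldType) (a r t u v : K) : u != 0 -> v != 0 ->
  a * (r / u) + t / v = (a * r * v + t * u) / (u * v).
Proof. by move=> u0 v0; rewrite mulrA addf_div. Qed.

(** * Submodules of the fraction field *)

Section FractionSubmodClosed.
Variables (R : idomainType) (m : idealr R).

Local Notation "r %:F" := (FracField.tofrac r).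

Lemma submodClosed_fracM (B : submodClosed {fraction R}) r q :
  q \in B -> r%:F * q \in B.
Proof. by move=> qB; rewrite -[_ * q]/(r *: q) rpredZ. Qed.

Lemma frac_numden (q : {fraction R}) : exists a w, w != 0 /\ q * w%:F = a%:F.
Proof.
exists \n_(repr q), \d_(repr q); split; first exact: denom_ratioP.
rewrite -[X in X * _](reprK q); unlock FracField.tofrac.
rewrite -[LHS]FracField.pi_mul; apply/eqmodP; rewrite /= FracField.equivfE /FracField.mulf.
by rewrite !numden_Ratio ?mulr1 ?oner_neq0 ?denom_ratioP // mulrC.
Qed.

(** Dividing an element n times by x inside B shows that its image lies in x^n S for every n, and S
    is x-adically separated. *)
Lemma divisible_hom0 (B : submodClosed {fraction R}) x : x \in m ->
  (forall q, q \in B -> exists2 p, p \in B & q = x%:F * p) ->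
  ~ Hom_neq0 (submodule B) (adic_completion m).
Proof.
move=> xm Bx [f [z /eqP]]; apply; apply: (ac_separated xm) => n.
elim: n z => [|n IHn] z; first by exists (f z); rewrite scale1r.
have [q qB zE] := Bx _ (valP z).
have -> : z = x *: (Submodule qB : submodule B) by apply: val_inj.
have [t tE] := IHn (Submodule qB); exists t.
by rewrite linearZ /= tE scalerA exprS.
Qed.

End FractionSubmodClosed.

(** * Excluding dimension zero and dimension above one *)

Section MainDirections.
Variables (R : idomainType) (m : idealr R).
Hypothesis Rnoeth : noetherian R.
Hypothesis Rlocal : local_with_maximal_ideal m.
Hypothesis Rnotfield : exists x : R, x != 0 /\ x \isn't a GRing.unit.

Local Notation "r %:F" := (FracField.tofrac r).

Lemma nonunit_mem x : x \isn't a GRing.unit -> x \in m.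
Proof.
move=> xu; apply/negPn/negP => /(local_inv Rnoeth Rlocal)[b xb].
by case/negP: xu; apply/unitrPr; exists b.
Qed.

(** The chain 0 < m has length 1, since m contains a nonzero nonunit. *)
Lemma krull_dim_gt0 d : has_krull_dim R d -> (0 < d)%N.
Proof.
move=> [_ Rd]; have [x [x0 /nonunit_mem xm]] := Rnotfield.
have [O OE] := zero_prime_idealr R.
have [M ME] := prime_idealr_of (local_prime Rnoeth Rlocal).
apply: (Rd 1%N (fun i : 'I_2 => if val i == 0%N then O else M)).
move=> [[|[|i]] Hi] // [[|[|j]] Hj] //= _; split=> [y /OE ->|]; first exact: rpred0.
by exists x; [rewrite ME | apply/negP => /OE /eqP; apply/negP].
Qed.

Lemma exists_hom0 d : has_krull_dim R d -> (1 < d)%N ->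
  exists B : submodClosed {fraction R}, [/\ exists2 b, b \in B & b != 0,
    exists q, q \notin B & ~ Hom_neq0 (submodule B) (adic_completion m)].
Proof.
move=> [[P PC] _] d1.
have lt01 : ((inord 0 : 'I_d.+1) < (inord 1 : 'I_d.+1))%N by rewrite !inordK // ltnW.
have lt12 : ((inord 1 : 'I_d.+1) < (inord 2 : 'I_d.+1))%N by rewrite !inordK // ltnW.
have [_ [w wP1 wP0]] := PC _ _ lt01.
have [_ [x xP2 xP1]] := PC _ _ lt12.
have w0 : w%:F != 0 by rewrite tofrac_eq0; apply: contraNneq wP0 => ->; exact: rpred0.
have x0 : x%:F != 0 by rewrite tofrac_eq0; apply: contraNneq xP1 => ->; exact: rpred0.
have xn0 n : x%:F ^+ n != 0 by rewrite expf_neq0.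
have xm : x \in m.
  apply: (local_sub Rnoeth Rlocal (idealr_is_ideal (P (inord 2)))) => //.
  by rewrite idealr1.
pose L : {pred {fraction R}} := fun q => `[< exists r n, q = r%:F / x%:F ^+ n >].
have LC : submod_closed L.
  split; first by apply/asboolP; exists 0, 0%N; rewrite tofrac0 mul0r.
  move=> a _ _ /asboolP[r [n ->]] /asboolP[t [k ->]]; apply/asboolP.
  exists (a * r * x ^+ k + t * x ^+ n), (n + k)%N.
  rewrite -[_ *: _]/(a%:F * _) tofracD !tofracM !tofracXn exprD.
  exact: scaled_div_add.
pose B : submodClosed {fraction R} :=
  HB.pack L (GRing.isSubmodClosed.Build R {fraction R} L LC).
exists B; split.
- exists 1; last exact: oner_neq0.
  by apply/asboolP; exists 1, 0%N; rewrite tofrac1 divr1.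
(* An equality 1 / w = r / x^n would put x^n = r w in the prime [P (inord 1)], which does not
   contain x. *)
- exists w%:F^-1; apply/asboolP => -[r [n wE]].
  have : x ^+ n = r * w.
    apply/eqP; rewrite -tofrac_eq tofracM tofracXn -[r%:F](divfK (xn0 n)) -wE.
    by rewrite mulrAC mulVf ?mul1r.
  have : r * w \in P (inord 1) by exact: idealMr.
  move=> + xnE; rewrite -xnE; apply/negP.
  elim: n {wE xnE} => [|n IHn]; first by rewrite idealr1.
  by rewrite exprS prime_idealrM negb_or xP1.
- apply: (divisible_hom0 xm) => q /asboolP[r [n ->]].
  exists (r%:F / x%:F ^+ n.+1); first by apply/asboolP; exists r, n.+1.
  by rewrite exprS invfM mulrCA mulVKf.
Qed.

End MainDirections.

(** * From a multiplier to a homomorphism *)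

Section MultiplierHom.
Variables (R : idomainType) (S : comAlgType R) (x : R).
Hypothesis x0 : x != 0.
Hypothesis Sx : complete_along S x.

Local Notation "r %:F" := (FracField.tofrac r).

(** The map sends v to (v g) y, where (r / x^k) y means the s with x^k s = r y. Since S is
    x-torsion-free, s does not depend on the fraction chosen, the map is linear, and x^n y, the
    image of b, is nonzero. *)
Lemma multiplier_hom (B : submodClosed {fraction R}) (g : {fraction R}) n (y : S) :
  y != 0 -> (exists2 b, b \in B & b * g = (x ^+ n)%:F) ->
  (forall q, exists k r, q = r%:F / x%:F ^+ k) ->
  (forall b k r, b \in B -> b * g = r%:F / x%:F ^+ k -> exists s, r *: y = x ^+ k *: s) ->
  Hom_neq0 (submodule B) S.
Proof.
move=> y0 [b bB bg] frac yB.
have ex (v : submodule B) : exists s : S, exists k r,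
    val v * g = r%:F / x%:F ^+ k /\ r *: y = x ^+ k *: s.
  have [k [r E]] := frac (val v * g); have [s sE] := yB _ _ _ (valP v) E.
  by exists s, k, r.
have [f fP] := choice ex.
have fE v k r s : val v * g = r%:F / x%:F ^+ k -> r *: y = x ^+ k *: s -> f v = s.
  move=> vE sE; have [l [t [tE fvE]]] := fP v.
  apply: (@complete_regX _ _ _ Sx (k + l)%N).
  have rt : r * x ^+ l = t * x ^+ k.
    apply/eqP; rewrite -tofrac_eq !tofracM !tofracXn.
    have <- : val v * g * x%:F ^+ k = r%:F by rewrite vE divfK // tofracX_neq0.
    have <- : val v * g * x%:F ^+ l = t%:F by rewrite tE divfK // tofracX_neq0.
    by rewrite mulrAC.
  have -> : x ^+ (k + l) *: f v = (t * x ^+ k) *: y.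
    by rewrite exprD -scalerA -fvE scalerA mulrC.
  have -> : x ^+ (k + l) *: s = (r * x ^+ l) *: y.
    by rewrite addnC exprD -scalerA -sE scalerA mulrC.
  by rewrite rt.
have flin : linear f.
  move=> a u v; have [k [r [uE fu]]] := fP u; have [l [t [vE fv]]] := fP v.
  apply: (fE _ (k + l)%N (a * r * x ^+ l + t * x ^+ k)).
    have -> : val (a *: u + v) = a%:F * val u + val v by [].
    rewrite mulrDl -mulrA uE vE tofracD !tofracM !tofracXn exprD.
    by apply: scaled_div_add; exact: tofracX_neq0.
  rewrite scalerDl [a * r * _]mulrAC -[(_ * r) *: y]scalerA fu.
  rewrite [t * _]mulrC -[(_ * t) *: y]scalerA fv !scalerA exprD scalerDr scalerA.
  by congr (_ *: _ + _); rewrite -mulrA mulrC [x ^+ l * _]mulrC.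
pose F : {linear submodule B -> S} :=
  HB.pack f (GRing.isLinear.Build R (submodule B) S *:%R f flin).
exists F, (Submodule bB).
rewrite -[F _]/(f _) (@fE _ 0%N (x ^+ n) (x ^+ n *: y)) ?scale1r ?divr1 //.
apply: contra_neq y0 => xy; apply: (@complete_regX _ _ _ Sx n).
by rewrite xy scaler0.
Qed.

End MultiplierHom.

(** * Nonzero homomorphisms in dimension one *)

Section DimensionOneHom.
Variables (R : idomainType) (m : idealr R).
Hypothesis Rnoeth : noetherian R.
Hypothesis Rlocal : local_with_maximal_ideal m.
Hypothesis Rnotfield : exists x : R, x != 0 /\ x \isn't a GRing.unit.
Hypothesis Rdim1 : has_krull_dim R 1.

Local Notation "r %:F" := (FracField.tofrac r).

Lemma dim1_hom_neq0 (B : submodClosed {fraction R}) :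
  (exists2 b, b \in B & b != 0) -> (exists q, q \notin B) ->
  Hom_neq0 (submodule B) (adic_completion m).
Proof.
move=> [b bB b0] [q0 q0B].
have [x [x0 xu]] := Rnotfield; have xm := nonunit_mem Rnoeth Rlocal xu.
have xF n : x%:F ^+ n != 0 := tofracX_neq0 x0 n.
have mx k : exists n, forall z, z \in ideal_exp m n -> exists c, z = x ^+ k * c.
  apply: (ideal_exp_sub Rnoeth Rlocal Rdim1 (principal_ideal (x ^+ k))).
  by exists (x ^+ k); rewrite expf_neq0 //; split=> //; exists 1; rewrite mulr1.
have Sx := adic_completion_along xm x0 mx.
have Rx (J : nat -> R -> Prop) : (forall n, is_ideal (J n)) ->
    (forall n z, J n.+1 z -> J n z) -> (forall n, J n x) ->
    exists n, forall k z, (n <= k)%N -> J n z -> J k z.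
  move=> Jid Jdec Jx; apply: (artinian Rnoeth Rlocal Rdim1 (principal_ideal x)) => //.
    by exists x; split=> //; exists 1; rewrite mulr1.
  by move=> n _ [c ->]; rewrite mulrC; exact: is_idealM.
(* Q = R[1/x]: a nonzero denominator w divides a power of x, because (w) contains a power of m. *)
have frac (q : {fraction R}) : exists k r, q = r%:F / x%:F ^+ k.
  have [a [w [w0 qE]]] := frac_numden q.
  have [|n nP] := ideal_exp_sub Rnoeth Rlocal Rdim1 (principal_ideal w).
    by exists w; split=> //; exists 1; rewrite mulr1.
  have [|c cE] := nP (x ^+ n).
    by case: (n) => [//|k]; exact: idealr_pow.
  exists n, (a * c); apply: (mulIf (xF n)); rewrite divfK //.
  by rewrite tofracM -qE -tofracXn cE tofracM mulrA.
(* B' = b^-1 B contains 1, and W j below is R + x^j B'. *)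
pose B' (p : {fraction R}) := b * p \in B.
have B'D p q : B' p -> B' q -> B' (p + q) by rewrite /B' mulrDr; exact: rpredD.
have B'Z r q : B' q -> B' (r%:F * q) by rewrite /B' mulrCA; exact: submodClosed_fracM.
pose W j (q : {fraction R}) := exists r (p : {fraction R}), B' p /\ q = r%:F + (x ^+ j)%:F * p.
have B'0 : B' 0 by rewrite /B' mulr0; exact: rpred0.
have WR j r : W j r%:F by exists r, 0; rewrite mulr0 addr0.
have WD j p q : W j p -> W j q -> W j (p + q).
  move=> [r [p' [Bp ->]]] [t [q' [Bq ->]]]; exists (r + t), (p' + q').
  by split; [exact: B'D | rewrite tofracD; ring].
have WZ j r q : W j q -> W j (r%:F * q).
  move=> [t [p [Bp ->]]]; exists (r * t), (r%:F * p).
  by split; [exact: B'Z | rewrite tofracM; ring].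
have WB j p : B' p -> W j ((x ^+ j)%:F * p).
  by move=> Bp; exists 0, p; rewrite tofrac0 add0r.
have Wdec j k q : W (j + k)%N q -> W j q.
  move=> [r [p [Bp ->]]]; exists r, ((x ^+ k)%:F * p); split; first exact: B'Z.
  by rewrite exprD tofracM mulrA.
have [||| n nP] := Rx (fun j r => W j (r%:F / x%:F)).
- move=> j; split.
  + by rewrite tofrac0 mul0r -(tofrac0 R).
  + by move=> r t Wr Wt; rewrite tofracD mulrDl; exact: WD.
  + by move=> r t Wt; rewrite tofracM -mulrA; exact: WZ.
- by move=> j r; rewrite -addn1; exact: Wdec.
- by move=> j; rewrite divff ?(xF 1%N) // -(tofrac1 R).
(* Multiplication by [x ^+ i] carries [W n] into [W (n + i)], and the latter  *)
(* agrees with [W (n + i).+1] on x^-1 R.                                      *)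
have stable i q : W n q -> (exists u, (x ^+ i)%:F * q = u%:F) -> W n.+1 q.
  elim: i q => [|i IHi] q Wq [u qu].
    by have -> : q = u%:F by rewrite -qu tofrac1 mul1r.
  have quE : (x ^+ i)%:F * q = u%:F / x%:F.
    by rewrite -qu exprS tofracM mulrAC [x%:F * _]mulrC mulfK ?(xF 1%N).
  have Wu : W (n + i)%N (u%:F / x%:F).
    rewrite -quE; have [r [p [Bp ->]]] := Wq; rewrite mulrDr -tofracM mulrA -tofracM.
    by rewrite -exprD [(i + n)%N]addnC; apply: (WD) => //; exact: WB.
  have [r [p [Bp uE]]] := nP (n + i).+1 u (leqW (leq_addr _ _)) (Wdec _ _ _ Wu).
  (* Subtracting x^(n+1) p lowers the denominator of q: x^i already carries the difference to r. *)
  have -> : q = (q - (x ^+ n.+1)%:F * p) + (x ^+ n.+1)%:F * p by rewrite subrK.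
  apply: (WD); last exact: WB.
  apply: IHi.
    apply: (WD) => //; rewrite -mulrN exprSr tofracM -mulrA; apply: (WB).
    by rewrite -mulN1r -(tofrac1 R) -tofracN; do 2!apply: (B'Z).
  exists r; rewrite mulrBr quE uE mulrA -tofracM -exprD.
  by rewrite addnS addnC addrK.
have Wdiv q : W n q -> exists r p, W n p /\ q = r%:F + x%:F * p.
  move=> Wq; have [i [u qE]] := frac q.
  have [|r [p [Bp ->]]] := stable i q Wq.
    by exists u; rewrite qE tofracXn mulrC divfK.
  exists r, ((x ^+ n)%:F * p); split; first exact: WB.
  by rewrite exprS tofracM mulrA.
have Wproper : exists i, ~ W n (x%:F ^- i).
  apply: contrapT => /forallNP Wall; case/negP: q0B.
  have B'x i : B' (x%:F ^- i).
    have /contrapT[r [p [Bp pE]]] := Wall i.+1.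
    (* Here x^n p = (1 - x^(i+1) r) / x^(i+1) with an invertible factor, so B' contains 1 / x^(i+1)
       and hence 1 / x^i. With all of these, B' would be Q. *)
    have [c cE] : exists c, (1 - x ^+ i.+1 * r) * c = 1.
      apply: (local_inv Rnoeth Rlocal); apply/negP => mem.
      have : 1 \in m.
        by rewrite -(subrK (x ^+ i.+1 * r) 1) rpredD // mulrC idealMr // exprS mulrC idealMr.
      by rewrite idealr1.
    have -> : x%:F ^- i = (c * x * x ^+ n)%:F * p; last exact: B'Z.
    have pE' : (x ^+ n)%:F * p = x%:F ^- i.+1 - r%:F by rewrite pE addrC addKr.
    rewrite tofracM -mulrA pE'; apply: (mulIf (xF i.+1)).
    rewrite -mulrA mulrBl mulVf // {1}exprS mulrCA mulVf // mulr1.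
    rewrite -tofracXn -tofracM -(tofrac1 R) -tofracB -tofracM.
    by rewrite mulrAC [c * _]mulrC [r * _]mulrC cE mul1r.
  have [i [u uE]] := frac (q0 / b).
  have : B' (q0 / b) by rewrite uE; exact: B'Z.
  by rewrite /B' mulrC divfK.
have [y y0 yP] := divisible_multiplier x0 Rnoeth Sx Rx (WR n 1) (WD n) (WZ n) Wdiv Wproper.
(* Scaling by g = x^n / b carries B onto x^n B', which lies in W n, and b to x^n. *)
apply: (multiplier_hom x0 Sx (g := (x ^+ n)%:F / b) (n := n) y0) => //.
  by exists b => //; rewrite mulrC divfK.
move=> b' k r b'B b'E; apply: yP; rewrite -b'E mulrCA; apply: (WB).
by rewrite /B' mulrC divfK.
Qed.

End DimensionOneHom.

Theorem theorem5p9 (R : idomainType) (m : idealr R) (d : nat)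
    (Rnoeth : noetherian R)
    (Rlocal : local_with_maximal_ideal m)
    (Rdim : has_krull_dim R d)
    (Rnotfield : exists x : R, x != 0 /\ x \isn't a GRing.unit) :
  (forall B : submodClosed {fraction R},
      (exists2 b, b \in B & b != 0) -> (exists q, q \notin B) ->
      Hom_neq0 (submodule B) (adic_completion m))
  <-> d = 1%N.
Proof.
split=> [allB|d1]; last by rewrite d1 in Rdim; exact: dim1_hom_neq0.
apply/eqP; rewrite eqn_leq (krull_dim_gt0 Rnoeth Rlocal Rnotfield Rdim) andbT.
rewrite leqNgt; apply/negP => /(exists_hom0 Rnoeth Rlocal Rdim)[B [Bn0 Bp]].
by apply; exact: allB.
Qed.
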